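(* Let $X$ be a locally compact and $\mathbb{N}$-compact space. Then $\beta_0X\setminus X$ is an almost $P$-space.
   Context: A space is $\mathbb{N}$-compact if it is homeomorphic to a closed subspace of $\mathbb{N}^\kappa$ for some cardinal $\kappa$, where $\mathbb{N}$ is discrete; such a space is zero-dimensional, i.e. Hausdorff with a base of clopen sets. The Banaschewski compactification $\beta_0X$ of a zero-dimensional space $X$ is the (unique up to homeomorphism) compact zero-dimensional space containing $X$ as a dense subspace such that every continuous function $X\to\{0,1\}$ extends continuously to $\beta_0X$. A topological space is an almost $P$-space if each of its nonempty $G_\delta$-subsets has nonempty interior. $\beta_0X\setminus X$ carries the subspace topology. *)

(* Defs.v *)
From mathcomp Require Import all_boot all_classical.
From mathcomp Require Import topology borel_hierarchy.

Set Implicit Arguments.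
Unset Strict Implicit.
Unset Printing Implicit Defensive.

Local Open Scope classical_set_scope.

Definition homeomorphic (X Y : topologicalType) : Prop :=
  exists (f : X -> Y) (g : Y -> X),
    [/\ continuous f, continuous g, cancel f g & cancel g f].

Definition N_compact (X : topologicalType) : Prop :=
  exists (I : Type) (F : set {ptws I -> nat}),
    closed F /\ homeomorphic X (set_type F).

(* The library's [zero_dimensional] only asks that distinct points be separated
   by a clopen set, which is weaker than having a base of clopen sets. *)
Definition hausdorff_clopen_base (X : topologicalType) : Prop :=
  hausdorff_space X /\ basis (@clopen X).

Definition embedding (X Y : topologicalType) (e : X -> Y) : Prop :=
  injective e /\
  forall U : set X, open U <-> exists2 V : set Y, open V & e @^-1` V = U.

(* [K], with [X] identified with its image under [e], is (a model of) the
   Banaschewski compactification of [X]. *)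
Definition is_banaschewski (X K : topologicalType) (e : X -> K) : Prop :=
  [/\ compact [set: K], hausdorff_clopen_base K, embedding e, dense (range e) &
      forall f : X -> bool, continuous f ->
        exists2 g : K -> bool, continuous g & forall x, g (e x) = f x].

Definition almost_P_space (X : topologicalType) : Prop :=
  forall G : set X, Gdelta G -> G !=set0 -> interior G !=set0.

(* Main.v *)
Require Import Defs.
From mathcomp Require Import all_boot all_classical.
From mathcomp Require Import topology borel_hierarchy.

(** Write [K] for the Banaschewski compactification and identify [X] with its
    image.  Let a [G_delta] subset of the remainder [K \ X] be cut out by open
    sets [U n] of [K], and let [p] be one of its points.

    Since [X] is N-compact and [p] lies outside [X], some sequence of clopen
    neighbourhoods [C n] of [p] has no point of [X] in common
    ([N_compact_clopen_separation]).  Shrinking, there are nested clopen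
    neighbourhoods [W n] of [p] with [W n] inside [U i] for all [i < n] and
    with the intersection of all [W n] disjoint from [X].

    By local compactness [X] is open in [K] ([open_range_locally_compact]), so
    by density each [W n] contains a nonempty clopen set [A n] of [K] lying
    inside [X].  Let [A] be the union of the [A n].  All but finitely many
    [A n] lie inside any given [W m], so the closure of [A] adds to [A] only
    points common to all the [W m] ([closure_bigcup_nested]); none of these is
    in [X].  Hence [A] is clopen in [X], and therefore is the trace of a clopen
    set [B] of [K] ([banaschewski_clopen]), which by density lies in the
    closure of [A].  So the part of [B] outside [X] is contained in every
    [W m].  It is open in the remainder, and it is nonempty: by compactness [B]
    has a point common to all the [W m]
    ([compact_nested_closed]). *)

Set Implicit Arguments.
Unset Strict Implicit.
Unset Printing Implicit Defensive.

Local Open Scope classical_set_scope.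

(** * Clopen sets and compactness *)

Lemma clopen_base_nbhs (K : topologicalType) (x : K) (U : set K) :
  hausdorff_clopen_base K -> open U -> U x ->
  exists W, [/\ clopen W, W x & W `<=` U].
Proof.
move=> [_ [_ base]] oU Ux.
by have [W [cW Wx] WU] := base x U (open_nbhs_nbhs (conj oU Ux)); exists W.
Qed.

Lemma clopen_bigcap_below (T : topologicalType) (D : nat -> set T) (n : nat) :
  (forall i, clopen (D i)) -> clopen (\bigcap_(i in `I_n) D i).
Proof.
move=> cD; elim: n => [|n IHn]; first by rewrite II0 bigcap_set0; exact: clopenT.
rewrite (_ : \bigcap_(i in `I_n.+1) D i = \bigcap_(i in `I_n) D i `&` D n).
  exact: clopenI.
rewrite IIS bigcap_setU bigcap_set1; congr (_ `&` _).
Qed.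

Lemma compact_nested_closed (T : topologicalType) (C : nat -> set T) :
  compact [set: T] -> (forall n, closed (C n)) -> (forall n, C n !=set0) ->
  (forall m n, m <= n -> C n `<=` C m) -> (\bigcap_n C n) !=set0.
Proof.
move=> cptT clC C0 decC.
have FF : ProperFilter (filter_from [set: nat] C).
  apply: filter_from_proper => [|n _]; last exact: C0.
  apply: filter_from_filter; first by exists 0%N.
  move=> m n _ _; exists (maxn m n) => // x Cx.
  by split; apply: decC Cx; rewrite ?leq_maxl ?leq_maxr.
have [x [_ clx]] := cptT _ FF (@filterT _ _ FF).
exists x => n _; apply: clC => U Ux.
by apply: clx => //; exists n.
Qed.

(** Outside [W n] the union of the [A i] coincides with that of the finitely many
    closed sets [A i] with [i < n], so it can only gain limit points that lie in
    every [W n]. *)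
Lemma closure_bigcup_nested (T : topologicalType) (A W : nat -> set T) :
  (forall n, closed (A n)) -> (forall n, closed (W n)) ->
  (forall n, A n `<=` W n) -> (forall m n, m <= n -> W n `<=` W m) ->
  closure (\bigcup_n A n) `<=` \bigcup_n A n `|` \bigcap_n W n.
Proof.
move=> clA clW AW decW y cly.
have [|nAy] := pselect ((\bigcup_n A n) y); first by left.
right=> n _.
have clE : closed (\bigcup_(i in `I_n) A i `|` W n).
  by apply: closedU => //; apply: closed_bigcup => //; exact: finite_II.
have [[i _ Aiy]|//] : (\bigcup_(i in `I_n) A i `|` W n) y.
  apply: clE; apply: closureS cly => z [m _ Amz].
  have [mn|nm] := ltnP m n; first by left; exists m.
  by right; apply: decW nm _ _; exact: AW.
by case: nAy; exists i.
Qed.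

(** * Dense embeddings *)

Lemma embedding_continuous (X K : topologicalType) (e : X -> K) :
  embedding e -> continuous e.
Proof. by move=> [_ eo]; apply/continuousP => A oA; apply/eo; exists A. Qed.

Lemma dense_open_sub_closure (X K : topologicalType) (e : X -> K) (B : set K) :
  dense (range e) -> open B -> B `<=` closure (e @` (e @^-1` B)).
Proof.
move=> de oB y By V; rewrite nbhsE => -[U [oU Uy] UV].
have [z [[Bz Uz] [x _ xE]]] :=
  de (B `&` U) (ex_intro _ y (conj By Uy)) (openI oB oU).
by exists (e x); split; [exists x => //= | apply: UV]; rewrite xE.
Qed.

(** If [V] is open and its trace on [X] lies in a compact [C], then by density
    [V] lies in the closure of [e @` C], which is [e @` C] itself. *)
Lemma open_range_locally_compact (X K : topologicalType) (e : X -> K) :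
  locally_compact [set: X] -> hausdorff_space K -> embedding e ->
  dense (range e) -> open (range e).
Proof.
move=> lcX hK ee de; rewrite openE => _ [x _ <-].
have [C nC [cC _]] := lcX x I; have ce := embedding_continuous ee.
have nxC : nbhs x C by move: nC; rewrite within_interior ?interiorT.
have clC : closed (e @` C).
  apply: compact_closed => //; apply: continuous_compact => //.
  exact: continuous_subspaceT.
have [V oV VE] : exists2 V, open V & e @^-1` V = interior C.
  by apply/ee.2; exact: open_interior.
apply: (@filterS _ _ _ V) => [y Vy|]; last first.
  apply: open_nbhs_nbhs; split => //.
  by have : interior C x by []; rewrite -VE.
have [z Cz <-] : (e @` C) y; last by exists z.
apply: clC; apply: closureS (dense_open_sub_closure de oV Vy).
by rewrite VE => _ [z /interior_subset Cz <-]; exists z.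
Qed.

(** The filter along which a point of [X] tends to [p] in [K]; density makes it
    proper. *)
Lemma trace_proper_filter (X K : topologicalType) (e : X -> K) (p : K) :
  dense (range e) -> ProperFilter (filter_from (nbhs p) (preimage e)).
Proof.
move=> de; apply: filter_from_proper.
  apply: filter_from_filter; first by exists setT; exact: filterT.
  by move=> U V nU nV; exists (U `&` V) => //; exact: filterI.
move=> V; rewrite nbhsE => -[U [oU Up] UV].
have [z [Uz [x _ xE]]] := de U (ex_intro _ p Up) oU.
by exists x; apply: UV; rewrite xE.
Qed.

(** The clopen set is read off from the extension to [K] of the indicator of
    [S]. *)
Lemma banaschewski_clopen (X K : topologicalType) (e : X -> K) (S : set X) :
  is_banaschewski e -> clopen S ->
  exists2 B, clopen B & e @^-1` B = S.
Proof.
move=> [_ _ _ _ ext] [oS cS].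
have [|g cg gE] := ext (fun x => x \in S).
  apply/continuousP => A _.
  have -> : (fun x => x \in S) @^-1` A =
    (if true \in A then S else set0) `|` (if false \in A then ~` S else set0).
    apply/seteqP; split=> x /=.
      have [Sx|Sx] := pselect (S x).
        by rewrite mem_set// => At; rewrite (mem_set At); left.
      by rewrite memNset// => Af; rewrite (mem_set Af); right.
    case; case: ifPn => // /set_mem At Sx; first by rewrite mem_set.
    by rewrite memNset.
  apply: openU; case: ifP => _ //; first exact: open0.
    exact: closed_openC.
  exact: open0.
exists (g @^-1` [set true]).
  apply: preimage_clopen => //.
  by split; [exact: discrete_open | exact: discrete_closed].
by apply/seteqP; split=> x /=; rewrite gE; [move/set_mem | exact: mem_set].
Qed.

(** * N-compactness *)

Lemma proj_cvg (X I : Type) (Phi : set_system X)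
    (h : X -> {ptws I -> nat}) (y : {ptws I -> nat}) :
  Filter Phi ->
  (forall i, Phi [set x | h x i = y i]) -> h @ Phi --> y.
Proof.
move=> FPhi hy; apply/cvg_sup => i U [_ [[V oV <-] Vy] VU].
suff : Phi (h @^-1` U) by [].
by apply: filterS (hy i) => x /= hxi; apply: VU; rewrite /= hxi.
Qed.

Lemma proj_clopen (I : Type) (i : I) (n : nat) :
  clopen [set y : {ptws I -> nat} | y i = n].
Proof.
have oP (A : set nat) : open [set y : {ptws I -> nat} | A (y i)].
  rewrite openE => y Ay.
  have /cvg_sup/(_ i) :
    nbhs (y : {ptws I -> nat}) --> (y : {ptws I -> nat}) by exact: cvg_id.
  apply; exists [set y : {ptws I -> nat} | A (y i)].
  by split=> //; exists A => //; exact: discrete_open.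
by split; [exact: (oP [set n]) | rewrite -openC; exact: (oP (~` [set n]))].
Qed.

(** View [X] as a closed subspace of a power of [nat].  Every fibre of a
    coordinate [f i] is the trace of a clopen set [E i n] of [K].  If for some
    [i] the point [p] avoids every [E i n], the complements of these sets form
    the required sequence.  Otherwise [p] lies in some [E i (y i)] for each [i],
    so as [x] tends to [p] in [K] its coordinates tend to [y]; the limit [y]
    belongs to the closed subspace, hence it comes from a point of [X], and this
    point has to be [p]. *)
Lemma N_compact_clopen_separation (X K : topologicalType) (e : X -> K) (p : K) :
  N_compact X -> is_banaschewski e -> ~ range e p ->
  exists C : nat -> set K,
    [/\ forall n, clopen (C n), forall n, C n p &
        forall x, exists n, ~ C n (e x)].
Proof.
move=> [I [F [clF [h [g [ch cg hK gK]]]]]] bK pX.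
have [_ [hdK _] ee de _] := bK.
pose f i x := set_val (h x) i : nat.
have cf i n : clopen [set x | f i x = n].
  have ch' : continuous (fun x => set_val (h x) : {ptws I -> nat}).
    by move=> x; apply: continuous_comp; [exact: ch | exact: initial_continuous].
  exact: preimage_clopen (proj_clopen i n) ch'.
have [E EP] : exists E : I -> nat -> set K,
    forall i n, clopen (E i n) /\ e @^-1` (E i n) = [set x | f i x = n].
  pose ext i n B := clopen B /\ e @^-1` B = [set x | f i x = n].
  have /choice[E EP] : forall i, exists E, forall n, ext i n (E n).
    move=> i; suff /choice[Ei EiP] : forall n, exists B, ext i n B by exists Ei.
    by move=> n; have [B cB BE] := banaschewski_clopen bK (cf i n); exists B.
  by exists E.
have [[i pE]|] := pselect (exists i, forall n, ~ E i n p).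
  exists (fun n => ~` E i n); split=> [n|n|x]; first 2 last.
  - exists (f i x) => /=; apply.
    by have [_ /seteqP[_ /(_ x)]] := EP i (f i x); apply.
  - exact: clopenC set0 (EP i n).1.
  - exact: pE.
move=> nE.
have /choice[y yE] : forall i, exists n, E i n p.
  by move=> i; apply: contrapT => /forallNP nEi; apply: nE; exists i.
exfalso; apply: pX.
set Phi := filter_from (nbhs p) (preimage e).
have PPhi : ProperFilter Phi by exact: trace_proper_filter.
have hy : (fun x => set_val (h x) : {ptws I -> nat}) @ Phi --> (y : {ptws I -> nat}).
  apply: proj_cvg => i; have [[oE _] <-] := EP i (y i).
  by exists (E i (y i)) => //; apply: open_nbhs_nbhs.
have Fy : F y.
  apply: (closed_cvg (F := Phi) (FF := PPhi) _ clF _ _ hy).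
  by apply: nearW => x; exact: set_valP.
pose z : set_type F := exist _ y (mem_set Fy).
have hz : h @ Phi --> z.
  move=> U [_ [[V oV <-] Vz] VU].
  have nV : nbhs (y : {ptws I -> nat}) V by exact: open_nbhs_nbhs.
  have PV : Phi [set x | V (set_val (h x))] := hy V nV.
  suff : Phi (h @^-1` U) by [].
  by apply: filterS PV => x /= Vx; apply: VU.
have ez : e @ Phi --> e (g z).
  move=> U /(embedding_continuous ee)/cg/hz PU.
  suff : Phi (e @^-1` U) by [].
  rewrite (_ : e @^-1` U = h @^-1` (g @^-1` (e @^-1` U))) //.
  by apply/seteqP; split=> x /=; rewrite hK.
have ep : e @ Phi --> p by move=> U nU; exists U.
by exists (g z) => //; exact: cvg_unique ez ep.
Qed.

(** * The remainder of the compactification *)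

(** The union of nonempty clopen sets of [K] chosen inside the traces of the
    [W n] on [X] is the trace of a clopen [B] of [K], and outside [X] the set
    [B] consists of limit points of that union. *)
Lemma clopen_in_remainder (X K : topologicalType) (e : X -> K)
    (W : nat -> set K) :
  locally_compact [set: X] -> is_banaschewski e ->
  (forall n, clopen (W n)) -> (forall m n, m <= n -> W n `<=` W m) ->
  (\bigcap_n W n) !=set0 -> (forall x, exists n, ~ W n (e x)) ->
  exists B : set K,
    [/\ open B, B `&` ~` range e !=set0 & B `&` ~` range e `<=` \bigcap_n W n].
Proof.
move=> lcX bK cW decW [p Wp] WX.
have [cptK hbK ee de _] := bK.
have oX : open (range e) by apply: open_range_locally_compact => //; case: hbK.
have /choice[A AP] : forall n, exists A,
    [/\ clopen A, A !=set0 & A `<=` W n `&` range e].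
  move=> n; have [oW _] := cW n.
  have [q Wq] := de (W n) (ex_intro _ p (Wp n I)) oW.
  have [A [cA Aq AW]] := clopen_base_nbhs hbK (openI oW oX) Wq.
  by exists A; split=> //; exists q.
have clA : closure (\bigcup_n A n) `<=` \bigcup_n A n `|` \bigcap_n W n.
  apply: closure_bigcup_nested => // n; first by have [[]] := AP n.
    by have [] := cW n.
  by have [_ _ AW] := AP n => x /AW[].
have cS : clopen (e @^-1` (\bigcup_n A n)).
  have ce := embedding_continuous ee; split.
    apply: open_comp => //; apply: bigcup_open => n _; by have [[]] := AP n.
  suff -> : e @^-1` (\bigcup_n A n) = e @^-1` closure (\bigcup_n A n).
    by apply: preimage_closed => //; exact: closed_closure.
  apply/seteqP; split=> x /=; first exact: subset_closure.
  by move=> /clA[//|Wx]; have [n] := WX x; case; exact: Wx.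
have [B [oB cB] BS] := banaschewski_clopen bK cS.
have AB n : A n `<=` B.
  move=> q Aq; have [_ _ /(_ q Aq)[_ [x _ xq]]] := AP n.
  rewrite -xq -[B _]/((e @^-1` B) x) BS /= xq; by exists n.
have BA : B `<=` closure (\bigcup_n A n).
  move=> q /(dense_open_sub_closure de oB); rewrite BS; apply: closureS.
  exact: image_preimage_subset.
exists B; split=> //.
- have [|||q Bq] := @compact_nested_closed K (fun n => B `&` W n) cptK.
  + by move=> n; apply: closedI => //; have [] := cW n.
  + move=> n; have [_ [q Aq] AW] := AP n; exists q; split; first exact: AB Aq.
    by have [] := AW q Aq.
  + by move=> m n mn q [Bq Wq]; split => //; exact: decW mn _ Wq.
  exists q; split; first by have [] := Bq 0 I.
  by move=> [x _ xq]; have [n] := WX x; case; rewrite xq; have [] := Bq n I.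
- move=> q [Bq Xq]; have [[n _ Aq]|//] := clA q (BA q Bq).
  by have [_ _ /(_ q Aq)[]] := AP n.
Qed.

(* [set_type A] carries the subspace topology. *)
Theorem theorem3p9 (X : topologicalType) :
  locally_compact [set: X] -> N_compact X ->
  forall (K : topologicalType) (e : X -> K),
    is_banaschewski e -> almost_P_space (set_type (~` range e)).
Proof.
move=> lcX NX K e bK G [U oU ->] [p Up].
have pX : ~ range e (set_val p) by exact: set_valP p.
have [_ hbK _ _ _] := bK.
have [C [cC Cp CX]] := N_compact_clopen_separation NX bK pX.
have /choice[D DP] : forall n, exists D : set K,
    [/\ clopen D, D (set_val p) & set_val @^-1` D `<=` U n].
  move=> n; have [V oV VU] := oU n.
  have Vp : V (set_val p) by rewrite -[V _]/((set_val @^-1` V) p) VU; exact: Up.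
  have [D [cD Dp DV]] := clopen_base_nbhs hbK oV Vp.
  by exists D; split=> //; rewrite -VU => q /DV.
(* Each stage [n] meets the first [n] conditions only, so [C n] and [U n] are
   reached at stage [n.+1]. *)
pose W n := \bigcap_(i in `I_n) (C i `&` D i).
have [|||x|B [oB [q [Bq qX]] BW]] := @clopen_in_remainder X K e W lcX bK.
- move=> n; apply: clopen_bigcap_below => i; apply: clopenI => //.
  by have [] := DP i.
- by move=> m n mn q Wq i im; apply: Wq; exact: leq_trans im mn.
- by exists (set_val p) => n _ i _; split=> //; have [] := DP i.
- have [n nC] := CX x; exists n.+1 => Wx; apply: nC.
  by have [] := Wx n (ltnSn n).
exists (exist _ q (mem_set qX)); apply: (@filterS _ _ _ (set_val @^-1` B)).
  move=> r Br n _; have [_ _] := DP n; apply.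
  by have [] := BW _ (conj Br (set_valP r)) n.+1 I n (ltnSn n).
by apply: open_nbhs_nbhs; split => //; exists B.
Qed.
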